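(* Let $q>2$ be a prime power, let $d$ be a positive integer, and let $s=\frac{q^{d+1}-1}{q-1}$. Let $G$ be a group containing a central subgroup $E$ of index $s+1$ isomorphic to the elementary abelian group of order $q^{d+1}$, and let $\phi$ be a group isomorphism from $E$ to the additive group of a vector space $V$ of dimension $d+1$ over $\mathrm{GF}(q)$. Then, for every $\ell\ge 2$, there is no reduced $(v,k,\lambda,n;\ell)$-linking system of difference sets in $G$ with McFarland parameters $$(v,k,\lambda,n)=\left(q^{d+1}(s+1),\ q^d s,\ q^d(s-q^d),\ q^{2d}\right)$$ in which two of the difference sets are McFarland/Dillon difference sets with respect to the same subgroup $E$ and the same isomorphism $\phi$.
   Context: Groups are written multiplicatively and are not assumed abelian. For a group $G$ of order $v$, a subset $D\subseteq G$ with $k$ elements is a $(v,k,\lambda,n)$-difference set in $G$ if the multiset $\{d_1d_2^{-1} : d_1,d_2\in D,\ d_1\neq d_2\}$ contains every non-identity element of $G$ exactly $\lambda$ times, where $n:=k-\lambda$. A subset $S$ of $G$ is identified with the element $\sum_{s\in S}s$ of the group ring $\mathbb{Z}[G]$, and $S^{(-1)}:=\sum_{s\in S}s^{-1}$. For $\ell\ge 2$, a collection $\{D_1,\dots,D_\ell\}$ of size $\ell$ of $(v,k,\lambda,n)$-difference sets in $G$ is a reduced $(v,k,\lambda,n;\ell)$-linking system of difference sets in $G$ if there are integers $\mu,\nu$ such that for all distinct $i,j$ there is some $(v,k,\lambda,n)$-difference set $D(i,j)$ in $G$ (not necessarily one of the $D_r$) with $D_iD_j^{(-1)}=(\mu-\nu)D(i,j)+\nu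 G$ in $\mathbb{Z}[G]$. A hyperplane of a $(d+1)$-dimensional vector space is a $d$-dimensional subspace; there are $s=\frac{q^{d+1}-1}{q-1}$ of them over $\mathrm{GF}(q)$. With $G,E,\phi,V$ as in the claim, let $H_1,\dots,H_s$ be the subgroups of $E$ that correspond under $\phi$ to the hyperplanes of $V$. A McFarland/Dillon difference set with respect to $E$ and $\phi$ is a set of the form $D=\sum_{i=1}^s g_iH_i$ (the union of the disjoint cosets $g_iH_i$), where $g_0,g_1,\dots,g_s$ is a complete set of coset representatives for $E$ in $G$ (one from each coset); any such $D$ is a difference set in $G$ with the McFarland parameters above. Different difference sets in the system may use different sets of coset representatives. *)

(* Defs.v *)
From HB Require Import structures.
From mathcomp Require Import all_boot all_order all_fingroup all_algebra.
From mathcomp Require Import all_solvable all_field.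

Set Implicit Arguments.
Unset Strict Implicit.
Unset Printing Implicit Defensive.

Import GRing.Theory.

Local Open Scope ring_scope.

(* The integral group ring Z[G] of a finite group G: the function a stands for
   the formal sum of the (a g) g, and the product is the convolution product. *)
Definition group_ring (G : finGroupType) : Type := {ffun G -> int}.

HB.instance Definition _ (G : finGroupType) :=
  GRing.Zmodule.on (group_ring G).

Section GroupRing.
Variable G : finGroupType.
Implicit Types (a b c : group_ring G) (g h : G) (S : {set G}).

Definition gelt (g : G) : group_ring G := [ffun h => (h == g)%:R].

Definition gmul a b : group_ring G :=
  [ffun g => \sum_(h : G) a h * b (h^-1 * g)%g].

Lemma gmulA : associative gmul.
Proof.
move=> a b c; apply/ffunP=> g; rewrite !ffunE.
under eq_bigr => h _ do rewrite ffunE mulr_sumr.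
under [RHS]eq_bigr => h _ do rewrite ffunE mulr_suml.
rewrite [RHS]exchange_big; apply: eq_bigr => h _ /=.
rewrite [RHS](reindex_inj (mulgI h)) /=; apply: eq_bigr => k _.
by rewrite mulKg invMg !mulgA mulrA.
Qed.

Lemma gmul1r : left_id (gelt 1%g) gmul.
Proof.
move=> a; apply/ffunP=> g; rewrite ffunE (bigD1 1%g) //= big1 => [|h nh1].
  by rewrite ffunE eqxx mul1r invg1 mul1g addr0.
by rewrite ffunE (negPf nh1) mul0r.
Qed.

Lemma gmulr1 : right_id (gelt 1%g) gmul.
Proof.
move=> a; apply/ffunP=> g; rewrite ffunE (bigD1 g) //= big1 => [|h nhg].
  by rewrite ffunE mulVg eqxx mulr1 addr0.
by rewrite ffunE -eq_mulVg1 (negPf nhg) mulr0.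
Qed.

Lemma gmulDl : left_distributive gmul +%R.
Proof.
move=> a b c; apply/ffunP=> g; rewrite !ffunE -big_split /=.
by apply: eq_bigr => h _; rewrite ffunE mulrDl.
Qed.

Lemma gmulDr : right_distributive gmul +%R.
Proof.
move=> a b c; apply/ffunP=> g; rewrite !ffunE -big_split /=.
by apply: eq_bigr => h _; rewrite ffunE mulrDr.
Qed.

Lemma gelt1_neq0 : gelt 1%g != 0 :> group_ring G.
Proof. by apply/eqP => /ffunP/(_ 1%g); rewrite !ffunE eqxx. Qed.

HB.instance Definition _ := GRing.Zmodule_isNzRing.Build (group_ring G)
  gmulA gmul1r gmulr1 gmulDl gmulDr gelt1_neq0.

Lemma gelt1 : gelt 1%g = 1 :> group_ring G.
Proof. by []. Qed.

Lemma geltM g h : gelt (g * h)%g = gelt g * gelt h.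
Proof.
apply/ffunP=> k; rewrite !ffunE (bigD1 g) //= big1 => [|u nug].
  by rewrite !ffunE eqxx mul1r addr0 -[in RHS](inj_eq (mulgI g)) mulKVg.
by rewrite ffunE (negPf nug) mul0r.
Qed.

Definition gset (S : {set G}) : group_ring G := \sum_(s in S) gelt s.

Definition gsetV (S : {set G}) : group_ring G := \sum_(s in S) gelt s^-1%g.

End GroupRing.

(* The last condition counts the occurrences of g in the multiset of the
   quotients of distinct elements of D. *)
Definition difference_set (G : finGroupType) (v k lambda n : nat)
    (D : {set G}) : Prop :=
  [/\ #|G| = v, #|D| = k, k = (n + lambda)%N &
      forall g : G, g != 1%g ->
        #|[set p in setX D D | (p.1 != p.2) && (p.1 * p.2^-1 == g)%g]|
          = lambda].

Definition reduced_linking_system (G : finGroupType) (v k lambda n l : nat)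
    (DD : {set {set G}}) : Prop :=
  [/\ (2 <= l)%N,
      #|DD| = l,
      forall D, D \in DD -> difference_set v k lambda n D &
      exists mu nu : int, forall D1 D2 : {set G},
        D1 \in DD -> D2 \in DD -> D1 != D2 ->
        exists2 D12 : {set G}, difference_set v k lambda n D12 &
          gset D1 * gsetV D2 = gset D12 *~ (mu - nu) + gset [set: G] *~ nu].

(* phi is only relevant on E. *)
Definition additive_isom (G : finGroupType) (E : {group G}) (V : zmodType)
    (phi : G -> V) : Prop :=
  [/\ {in E &, {morph phi : x y / (x * y)%g >-> x + y}},
      {in E &, injective phi} &
      forall w : V, exists2 x, x \in E & phi x = w].

Definition hyperplane (F : fieldType) (V : vectType F) (W : {vspace V}) : Prop :=
  (\dim W).+1 = \dim {:V}.

Definition hyperplane_enum (F : fieldType) (V : vectType F) (s : nat)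
    (W : 'I_s -> {vspace V}) : Prop :=
  injective W /\ forall U : {vspace V}, hyperplane U <-> exists i, W i = U.

Definition subgroup_of (G : finGroupType) (E : {group G}) (F : fieldType)
    (V : vectType F) (phi : G -> V) (W : {vspace V}) : {set G} :=
  [set x in E | phi x \in W].

Definition coset_representatives (G : finGroupType) (E : {group G}) (m : nat)
    (g : 'I_m -> G) : Prop :=
  forall x : G, exists! i : 'I_m, x \in (g i *: E)%g.

(* The representative g ord0 is the one that is not used in D. *)
Definition mcfarland_dillon (G : finGroupType) (E : {group G}) (F : fieldType)
    (V : vectType F) (phi : G -> V) (s : nat) (D : {set G}) : Prop :=
  exists (W : 'I_s -> {vspace V}) (g : 'I_s.+1 -> G),
    [/\ hyperplane_enum W,
        coset_representatives E g &
        D = \bigcup_(i < s) (g (lift ord0 i) *: subgroup_of E phi (W i))%g].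

(* Main.v *)
Require Import Defs.
From HB Require Import structures.
From mathcomp Require Import all_boot all_order all_fingroup all_algebra.
From mathcomp Require Import all_solvable all_field.
From mathcomp Require Import zify.

(** Let D1 and D2 be the two Dillon sets. Indexing both by one enumeration of
the hyperplane subgroups, D1 is the union of the a_i H_i and D2 that of the
b_i H_i, with a_0 E and b_0 E the cosets that they miss. The coefficient of x in
D1 D2^(-1) is the size c(x) of the intersection of D1 and x D2, and the linking
equation says that c is constant on the third difference set D and on its
complement. So c takes at most two values, and the proof finds a third one.

Put r = q^(d-1) and z_i = a_i b_i^-1, let nE(x) be the number of i >= 1 with x
in z_i E, nH(x) the number of those with x in z_i H_i, and delta(x) = 1 or 0
according to whether x is in z_0 E. Two distinct hyperplanes meet in r elements,
and translates of them by E do too, so that ([card_translateI])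
  c(x) = r (s - 1 + delta(x) - nE(x) + q nH(x)).
On a coset xE the functions nE and delta are constant and nH has mean nE(x) / q;
hence c has mean r (s - 1 + delta(x)) there. If nE(x) > 0, then c is not
constant on xE: if x is in z_i E, the average of nH on z_i H_i is
1 + (nE(x) - 1) / q, which exceeds nE(x) / q. So c lies strictly above its mean
somewhere in xE ([exists_above]), and strictly below it elsewhere in xE
([exists_below]).

All the s cosets of E other than z_0 E have the same mean r (s - 1).
- If nE vanishes on one of them, then c takes the value r (s - 1), so no other
  one can have nE > 0, as this would give values on both sides of r (s - 1).
  Then c is constant off z_0 E but not on z_0 E, which forces D or its
  complement into the single coset z_0 E; both are too large for that
  ([single_coset_card]).
- Otherwise nE > 0 on each of these s cosets. As nE adds up to s over all the
  cosets ([sum_nE]), it is 1 on each of them and 0 on z_0 E. Then c takes the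
  values r (s - 2) and r (s - 2 + q) off z_0 E, and r s on it; these are three
  values, because q > 2. *)

Set Implicit Arguments.
Unset Strict Implicit.
Unset Printing Implicit Defensive.

(** * Counting in families of sets *)

Lemma card_bigcupI (T I : finType) (F : I -> {set T}) (X : {set T}) :
  (forall i j, i != j -> [disjoint F i & F j]) ->
  #|(\bigcup_i F i) :&: X| = \sum_i #|F i :&: X|.
Proof.
move=> disjF; rewrite big_distrl /= -sum1_card partition_disjoint_bigcup.
  by apply: eq_bigr => i _; rewrite sum1_card.
move=> i j /disjF; rewrite -!setI_eq0 => /eqP dij.
by rewrite setIACA dij set0I.
Qed.

Lemma sum_mem_card (T I : finType) (F : I -> {set T}) (X : {set T}) :
  \sum_(y in X) \sum_i (y \in F i) = \sum_i #|X :&: F i|.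
Proof.
rewrite exchange_big /=; apply: eq_bigr => i _.
rewrite -big_mkcondr /= sum1_card; apply: eq_card => y.
by rewrite inE.
Qed.

(** * Cosets *)

Section Cosets.
Variable gT : finGroupType.
Implicit Types (K E A B : {group gT}) (x y u w e : gT).

(** The condition on the left compares the cosets u K and x w K; centrality
turns it into membership of x in one coset of the same K, rather than of a
conjugate. *)
Lemma mem_lcoset_central K u x w :
  K \subset 'Z([set: gT])%g ->
  ((u^-1 * x * w)%g \in K) = (x \in ((u * w^-1) *: K)%g).
Proof.
move=> /sub_center_normal/andP[_ /subsetP nK].
rewrite mem_lcoset invMg invgK -(memJ_norm (w * u^-1 * x)%g (nK w (in_setT w))).
by rewrite conjgE !mulgA mulVg mul1g.
Qed.

(** When e = ab, the cosets A = aA and eB = aB both contain a, so that they meet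
in a coset of the intersection of A and B. *)
Lemma card_lcosetI_mul A B e :
  e \in (A * B)%g -> #|A :&: (e *: B)%g| = #|A :&: B|.
Proof.
case/mulsgP=> a b Aa Bb ->.
rewrite -(card_lcoset (A :&: B) a); apply: eq_card => y.
rewrite !(inE, mem_lcoset) invMg -mulgA [in LHS]groupMl ?groupV //.
by rewrite [in RHS]groupMl ?groupV.
Qed.

Lemma card_lcosetI A B u w :
  #|(u *: A)%g :&: (w *: B)%g| = #|A :&: ((u^-1 * w)%g *: B)%g|.
Proof.
rewrite -[RHS](card_lcoset _ u); apply: eq_card => y.
by rewrite !(inE, mem_lcoset) invMg invgK -!mulgA mulKVg.
Qed.

Lemma sum_mem_representatives E m (a : 'I_m -> gT) y :
  coset_representatives E a -> \sum_i (y \in (a i *: E)%g) = 1.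
Proof.
move=> repa; have [i [yi uniq_i]] := repa y.
rewrite (bigD1 i) //= yi big1 // => j nji.
by case: (boolP (y \in _)) => // /uniq_i eij; rewrite eij eqxx in nji.
Qed.

Lemma mem_lcoset_same E x y u :
  y \in (x *: E)%g -> (y \in (u *: E)%g) = (x \in (u *: E)%g).
Proof. by move/lcoset_eqP=> exy; rewrite !(sameP lcoset_eqP eqP) exy. Qed.

End Cosets.

(** * Intersection numbers of two Dillon sets *)

Section TwoDillonSets.
(* Here r stands for q ^ (d - 1), the size of the intersection of two
   hyperplanes. *)
Variables (gT : finGroupType) (E : {group gT}) (s q r : nat).
Variables (H : 'I_s -> {group gT}) (a b : 'I_s.+1 -> gT).
Hypotheses (q_gt2 : 2 < q) (q_lt_s : q < s) (r_gt0 : 0 < r).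
Hypotheses (cE : E \subset 'Z([set: gT])%g) (oE : #|E| = r * q ^ 2).
Hypothesis oG : #|[set: gT]| = #|E| * s.+1.
Hypotheses (sHE : forall i, H i \subset E) (oH : forall i, #|H i| = r * q).
Hypothesis oHI : forall i j e,
  i != j -> e \in E -> #|H i :&: (e *: H j)%g| = r.
Hypotheses (repa : coset_representatives E a).
Hypotheses (repb : coset_representatives E b).

Let a' (i : 'I_s) := a (lift ord0 i).
Let b' (i : 'I_s) := b (lift ord0 i).
Let z (i : 'I_s) := (a' i * (b' i)^-1)%g.
Let z0 := (a ord0 * (b ord0)^-1)%g.
Let A := \bigcup_(i < s) (a' i *: H i)%g.
Let B := \bigcup_(i < s) (b' i *: H i)%g.
Let nE x := \sum_i (x \in (z i *: E)%g).
Let nH x := \sum_i (x \in (z i *: H i)%g).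

Let cH i : H i \subset 'Z([set: gT])%g.
Proof. exact: subset_trans (sHE i) cE. Qed.

Lemma disjoint_representatives (c : 'I_s.+1 -> gT) (i j : 'I_s) :
    coset_representatives E c -> i != j ->
  [disjoint (c (lift ord0 i) *: H i)%g & (c (lift ord0 j) *: H j)%g].
Proof.
move=> repc; apply: contraR => /pred0Pn[y /andP[yi yj]].
have [k [_ uniq_k]] := repc y.
have := uniq_k (lift ord0 i) (subsetP (mulgS _ (sHE i)) y yi).
rewrite (uniq_k (lift ord0 j) (subsetP (mulgS _ (sHE j)) y yj)).
by move/lift_inj->.
Qed.

Lemma card_subgroupI i j e : i != j -> #|H i :&: (e *: H j)%g| = r * (e \in E).
Proof.
move=> nij; case: (boolP (e \in E)) => [Ee|nEe]; first by rewrite oHI ?muln1.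
rewrite muln0; apply: eq_card0 => y; apply/negbTE/negP.
rewrite in_setI mem_lcoset => /andP[/(subsetP (sHE i)) Ey /(subsetP (sHE j))].
by rewrite groupMr // groupV (negPf nEe).
Qed.

(** The intersection is empty or a whole coset when i = j, and empty or of size
r when i <> j. The summand on the left lets the first term on the right follow
the same rule for all the pairs. *)
Lemma card_cell x i j :
  #|(a' i *: H i)%g :&: ((x * b' j)%g *: H j)%g|
    + (i == j) * (r * (x \in (z i *: E)%g))
  = r * ((a' i)^-1 * x * b' j \in E)%g
    + (i == j) * (r * q * (x \in (z i *: H i)%g)).
Proof.
rewrite card_lcosetI mulgA; case: eqVneq => [<-|nij].
  rewrite -!mem_lcoset_central //; set e := (_ * x * _)%g.
  rewrite !mul1n addnC; congr (_ + _).
  case: (boolP (e \in H i)) => [He|nHe].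
    by rewrite lcoset_id // setIid oH muln1.
  rewrite muln0; apply: eq_card0 => y; apply/negbTE/negP.
  rewrite in_setI mem_lcoset => /andP[Hy]; rewrite groupMr //.
  by rewrite groupV (negPf nHe).
by rewrite !mul0n !addn0 card_subgroupI.
Qed.

(** In the table indexed by all the representatives, index 0 included, each row
and each column has exactly one 1. Removing row 0 and column 0 removes two 1s,
or a single one if it lies in the corner, that is, if x lies in z_0 E. *)
Lemma sum_pairs_representatives x :
  (\sum_i \sum_j ((a' i)^-1 * x * b' j \in E)%g).+1 = s + (x \in (z0 *: E)%g).
Proof.
pose f i j : nat := ((a i)^-1 * x * b j \in E)%g.
have sumj i : \sum_j f i j = 1.
  rewrite -(sum_mem_representatives (x^-1 * a i)%g repb); apply: eq_bigr => j _.
  by rewrite /f -[in LHS]groupV mem_lcoset !invMg !invgK !mulgA.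
have sumi j : \sum_i f i j = 1.
  rewrite -(sum_mem_representatives (x * b j)%g repa); apply: eq_bigr => i _.
  by rewrite /f mem_lcoset mulgA.
rewrite -mem_lcoset_central //.
change ((\sum_(i < s) \sum_(j < s) f (lift ord0 i) (lift ord0 j)).+1
  = s + f ord0 ord0).
have sum_f : \sum_i \sum_j f i j = s.+1.
  by rewrite (eq_bigr _ (fun i _ => sumj i)) sum_nat_const card_ord muln1.
move: f sumi sumj sum_f => f sumi sumj sum_f.
have := sumi ord0; have := sumj ord0; move: sum_f.
rewrite !big_ord_recl /= (eq_bigr _ (fun i _ => big_ord_recl _ _)) big_split /=.
lia.
Qed.

(** Sum [card_cell] over all i and j. The identity is arranged so as to avoid
subtraction in the natural numbers. *)
Lemma card_translateI x :
  #|A :&: (x *: B)%g| + r * (nE x).+1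
  = r * (s + (x \in (z0 *: E)%g) + q * nH x).
Proof.
have xB : (x *: B)%g = \bigcup_j ((x * b' j)%g *: H j)%g.
  apply/setP=> y; rewrite mem_lcoset; apply/bigcupP/bigcupP => -[j _ yj].
    by exists j => //; move: yj; rewrite !mem_lcoset invMg -mulgA.
  by exists j => //; move: yj; rewrite !mem_lcoset invMg -mulgA.
have disjB i j : i != j ->
    [disjoint ((x * b' i)%g *: H i)%g & ((x * b' j)%g *: H j)%g].
  move=> /(disjoint_representatives repb).
  apply: contraTT => /pred0Pn[y /andP[yi yj]].
  move: (yi : y \in _) (yj : y \in _).
  rewrite !mem_lcoset !invMg -!mulgA => {}yi {}yj.
  by apply/pred0Pn; exists (x^-1 * y)%g; rewrite /= !mem_lcoset yi.
have cardI : #|A :&: (x *: B)%g|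
    = \sum_i \sum_j #|(a' i *: H i)%g :&: ((x * b' j)%g *: H j)%g|.
  rewrite card_bigcupI => [|i j]; last exact: disjoint_representatives.
  apply: eq_bigr => i _; rewrite setIC xB card_bigcupI //.
  by apply: eq_bigr => j _; rewrite setIC.
have sum_diag (f : 'I_s -> nat) : \sum_i \sum_j (i == j) * f i = \sum_i f i.
  apply: eq_bigr => i _; rewrite (bigD1 i) //= eqxx mul1n big1 ?addn0 // => j.
  by rewrite eq_sym => /negPf->.
have: \sum_i \sum_j (#|(a' i *: H i)%g :&: ((x * b' j)%g *: H j)%g|
          + (i == j) * (r * (x \in (z i *: E)%g)))
    = \sum_i \sum_j (r * ((a' i)^-1 * x * b' j \in E)%g
          + (i == j) * (r * q * (x \in (z i *: H i)%g))).
  by apply: eq_bigr => i _; apply: eq_bigr => j _; apply: card_cell.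
under eq_bigr => i _ do rewrite big_split /=.
under [in RHS]eq_bigr => i _ do rewrite big_split /= -big_distrr /=.
rewrite !big_split /= -cardI !sum_diag -!big_distrr /= -/(nE x) -/(nH x).
rewrite mulnS mulnDr -sum_pairs_representatives mulnS -mulnA => cardE.
by rewrite addnCA cardE addnA.
Qed.

Lemma card_lcoset_zI x i :
  #|(x *: E)%g :&: (z i *: H i)%g| = r * q * (x \in (z i *: E)%g).
Proof.
case: (boolP (x \in _)) => xz; last first.
  rewrite muln0; apply: eq_card0 => y; apply/negbTE/negP.
  rewrite inE => /andP[/mem_lcoset_same yx /(subsetP (mulgS _ (sHE i)))].
  by rewrite yx (negPf xz).
rewrite (lcoset_eqP xz) (setIidPr _) ?mulgS //.
by rewrite card_lcoset oH muln1.
Qed.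

Lemma card_lcosetI_zz i j : i != j ->
  #|(z i *: H i)%g :&: (z j *: H j)%g| = r * (z i \in (z j *: E)%g).
Proof.
move=> nij; rewrite card_lcosetI card_subgroupI // mem_lcoset.
by rewrite -[in RHS]groupV (invMg (z j)^-1%g) invgK.
Qed.

(** If x is in z_i E, the sum of nH over the rq elements of z_i H_i is
rq + r (nE x - 1): the coset itself contributes rq, and each of the other
nE x - 1 cosets contributes r. If nH were at most nE x / q, this sum would be
at most r nE x, whence q <= 1. *)
Lemma exists_above x : 0 < nE x ->
  exists2 y, y \in (x *: E)%g & nE x < q * nH y.
Proof.
move=> gt0_nE; have [i xzi] : exists i, x \in (z i *: E)%g.
  apply/existsP; apply: contraTT gt0_nE => /existsPn nz.
  rewrite -leqNgt leqn0 /nE sum_nat_eq0.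
  by apply/forallP=> i; rewrite (negPf (nz i)).
have sH : (z i *: H i \subset x *: E)%g.
  by rewrite (lcoset_eqP xzi) mulgS.
have sum_nH : \sum_(y in (z i *: H i)%g) nH y + r = r * q + r * nE x.
  rewrite sum_mem_card (bigD1 i) //= setIid card_lcoset oH -addnA.
  congr (_ + _); rewrite /nE [in RHS](bigD1 i) //= xzi mulnDr muln1 addnC.
  congr (_ + _); rewrite big_distrr; apply: eq_bigr => j nji /=.
  by rewrite card_lcosetI_zz 1?eq_sym // (mem_lcoset_same _ xzi).
apply/exists_inP; apply: contraT => /exists_inPn nH_le.
have: q * \sum_(y in (z i *: H i)%g) nH y <= r * q * nE x.
  rewrite big_distrr /= -(oH i) -(card_lcoset _ (z i)) -sum_nat_const.
  by apply: leq_sum => y /(subsetP sH)/nH_le; rewrite -leqNgt.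
nia.
Qed.

(** Over the coset xE the mean of q nH is nE x: a value above the mean
forces another one below it. *)
Lemma exists_below x : 0 < nE x ->
  exists2 y, y \in (x *: E)%g & q * nH y < nE x.
Proof.
move=> gt0_nE; have [y0 xy0 lt_nE] := exists_above gt0_nE.
apply/exists_inP; apply: contraT => /exists_inPn nH_ge.
have: \sum_(y in (x *: E)%g) nE x < \sum_(y in (x *: E)%g) q * nH y.
  rewrite [X in X < _](bigD1 y0) //= [X in _ < X](bigD1 y0) //=.
  rewrite -addSn leq_add //; apply: leq_sum => y /andP[/nH_ge].
  by rewrite -leqNgt.
rewrite sum_nat_const card_lcoset oE -big_distrr /= sum_mem_card.
rewrite (eq_bigr _ (fun i _ => card_lcoset_zI x i)) -big_distrr /= -/(nE x).
nia.
Qed.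

Lemma nE_lcoset x y : y \in (x *: E)%g -> nE y = nE x.
Proof. by move=> xy; apply: eq_bigr => i _; rewrite (mem_lcoset_same _ xy). Qed.

Lemma nH_le_nE x : nH x <= nE x.
Proof.
apply: leq_sum => i _; have := subsetP (mulgS [set z i] (sHE i)) x.
by case: (x \in _) => // ->.
Qed.

(** The a_i represent all the cosets of E, and each z_j lies in exactly one. *)
Lemma sum_nE : \sum_i nE (a i) = s.
Proof.
rewrite exchange_big /= -[RHS]muln1 -[in RHS](card_ord s) -sum_nat_const.
apply: eq_bigr => j _; rewrite -(sum_mem_representatives (z j) repa).
by apply: eq_bigr => i _; rewrite lcoset_sym.
Qed.

(** A coset of E has r q ^ 2 elements: fewer than the r q s elements of D,
because q < s, and fewer than the r q (q (s + 1) - s) elements of its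
complement. *)
Lemma single_coset_card (D : {set gT}) (x : gT) (D_x : bool) :
  #|D| = r * q * s ->
  ~ forall y, y \notin (x *: E)%g -> (y \in D) = D_x.
Proof.
move=> oD Dout; case: D_x Dout => Dout.
  have: #|~: D| <= #|(x *: E)%g|.
    apply: subset_leq_card; apply/subsetP=> y; rewrite inE.
    by apply: contraR => /Dout->.
  have := cardsC D; rewrite -cardsT oG card_lcoset oE oD; nia.
have: #|D| <= #|(x *: E)%g|.
  by apply/subset_leq_card/subsetP=> y; apply: contraTT => /Dout->.
rewrite card_lcoset oE oD; nia.
Qed.

(** The two cases are whether nE vanishes somewhere off z_0 E. *)
Lemma card_translateI_not_two_valued (D : {set gT}) :
  #|D| = r * q * s ->
  ~ forall x y, (x \in D) = (y \in D) ->
      #|A :&: (x *: B)%g| = #|A :&: (y *: B)%g|.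
Proof.
pose c x := #|A :&: (x *: B)%g|; pose delta x := x \in (z0 *: E)%g.
move=> oD twoD.
have {}twoD x y : (x \in D) = (y \in D) -> c x = c y by apply: twoD.
have no_three x y w : c x < c y -> c y < c w -> False.
  move=> xy yw; have: (x \in D == (y \in D)) || (y \in D == (w \in D))
                      || (x \in D == (w \in D)).
    by case: (x \in D); case: (y \in D); case: (w \in D).
  by case/orP=> [/orP[]|] /eqP/twoD e; move: xy yw; rewrite e; lia.
have c_def x : c x + r * (nE x).+1 = r * (s + delta x + q * nH x).
  exact: card_translateI.
have delta_lcoset x y : y \in (x *: E)%g -> delta y = delta x.
  exact: mem_lcoset_same.
have above x : 0 < nE x ->
    exists2 y, delta y = delta x & r * (s + delta x) < c y + r.
  move=> /exists_above[y xy]; rewrite -(nE_lcoset xy) -(delta_lcoset _ _ xy).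
  move=> lt_nE; exists y => //; move: (c_def y); nia.
have below x : 0 < nE x ->
    exists2 y, delta y = delta x & c y + r < r * (s + delta x).
  move=> /exists_below[y xy]; rewrite -(nE_lcoset xy) -(delta_lcoset _ _ xy).
  move=> lt_nE; exists y => //; move: (c_def y); nia.
have s_gt0 : 0 < s by lia.
case: (pickP (fun x => ~~ delta x && (nE x == 0))) => [x0 | gt0_nE].
  move=> /andP[/negPf dx0 /eqP nE_x0].
  have c_x0 : c x0 + r = r * s.
    have := c_def x0; have := nH_le_nE x0; rewrite nE_x0 leqn0 => /eqP->.
    by rewrite dx0 muln1 muln0 !addn0.
  (* Otherwise c takes values below, at and above r (s - 1). *)
  have nE0 x : ~~ delta x -> nE x = 0.
    move/negPf=> dx; apply/eqP; rewrite -leqn0 leqNgt; apply/negP => nE_x.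
    have [y _ cy] := above x nE_x; have [y' _ cy'] := below x nE_x.
    by apply: (no_three y' x0 y); move: cy cy'; rewrite dx addn0; lia.
  have c0 x : ~~ delta x -> c x = c x0.
    move=> dx; apply/eqP; rewrite -(eqn_add2r r) c_x0 -(addn0 (c x + r)).
    have := c_def x; have := nH_le_nE x; rewrite nE0 // leqn0 => /eqP->.
    by rewrite (negPf dx) muln1 muln0 !addn0 => ->.
  apply: (@single_coset_card D z0 (x0 \in D)) => // y dy.
  (* If membership in D varied off z_0 E, then c, which is constant there, would
     be constant everywhere; it is not constant on the coset of z_1. *)
  have nE_z : 0 < nE (z (Ordinal s_gt0)).
    by rewrite /nE (bigD1 (Ordinal s_gt0)) //= lcoset_refl.
  have [u _ cu] := above _ nE_z; have [w _ cw] := below _ nE_z.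
  apply/eqP; apply: contraT => nyx.
  have: c u = c w; last by lia.
  have cD v : c v = c x0.
    case: (eqVneq (v \in D) (x0 \in D)) => [/twoD //|nvx].
    rewrite -(c0 y dy); apply: twoD.
    by move: nvx nyx; case: (v \in D); case: (y \in D); case: (x0 \in D).
  by rewrite !cD.
have [i0 [z0i0 uniq_i0]] := repa z0.
have nE_gt0 i : i != i0 -> 0 < nE (a i).
  move=> ni; have := gt0_nE (a i); rewrite lt0n => /negbT.
  rewrite negb_and negbK => /orP[|//]; rewrite /delta lcoset_sym => /uniq_i0 ei.
  by rewrite ei eqxx in ni.
(* The counts nE (a i) are positive for the s indices i <> i0 and add up to s;
   i1 is any index other than i0. *)
pose i1 := lift i0 (Ordinal s_gt0).
have ni1 : i1 != i0 by rewrite eq_sym neq_lift.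
have [nE_i0 nE_i1] : nE (a i0) = 0 /\ nE (a i1) = 1.
  have := sum_nE; rewrite (bigD1 i0) //= (bigD1 i1) //= => sumE.
  have sum1 : \sum_(i < s.+1) 1 = s.+1 by rewrite sum_nat_const card_ord muln1.
  move: sum1; rewrite (bigD1 i0) //= (bigD1 i1) //= => sum1.
  have nE_i1 := nE_gt0 _ ni1.
  have: \sum_(i < s.+1 | (i != i0) && (i != i1)) 1
      <= \sum_(i < s.+1 | (i != i0) && (i != i1)) nE (a i).
    by apply: leq_sum => i /andP[/nE_gt0].
  move: sum1 sumE; set n1 := \sum_(i < _ | _) 1; set n2 := \sum_(i < _ | _) _.
  move: n1 n2 (nE (a i0)) (nE (a i1)) nE_i1 => n1 n2 t0 t1.
  by lia.
have d_i0 : delta (a i0) by rewrite /delta lcoset_sym.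
have d_i1 : delta (a i1) = false.
  apply/negbTE; apply: contra ni1; rewrite /delta lcoset_sym => /uniq_i0 ->.
  exact: eqxx.
have nE_i1_gt0 : 0 < nE (a i1) by rewrite nE_i1.
have [u xu nH_u_gt] := exists_above nE_i1_gt0.
have [w xw nH_w_lt] := exists_below nE_i1_gt0.
(* The three values are r (s - 2) at w, r s at a i0, and r (s - 2 + q) at u. *)
have c_i0 : c (a i0) + r = r * s.+1.
  have := c_def (a i0); have := nH_le_nE (a i0); rewrite nE_i0 leqn0 => /eqP->.
  by rewrite d_i0 muln1 muln0 addn0 addn1.
have nH_w : nH w = 0 by move: nH_w_lt; rewrite nE_i1; case: (nH w) => // n; nia.
have nH_u : nH u = 1.
  move: (nH_le_nE u) nH_u_gt; rewrite (nE_lcoset xu) nE_i1.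
  by case: (nH u) => [|[]] //; rewrite muln0.
have := c_def w; have := c_def u.
rewrite (nE_lcoset xw) (nE_lcoset xu).
rewrite (delta_lcoset _ _ xw) (delta_lcoset _ _ xu) d_i1.
rewrite nE_i1 nH_w nH_u muln1 muln0 !addn0 => cu cw.
by apply: (no_three w (a i0) u); nia.
Qed.

End TwoDillonSets.

(** * Coefficients in the group ring *)

Section GroupRingCoefficients.
Import GRing.Theory.
Local Open Scope ring_scope.
Variable gT : finGroupType.
Implicit Types (S : {set gT}) (x : gT).

Lemma gset_coef S x : gset S x = (x \in S)%:R.
Proof.
rewrite sum_ffunE big_mkcond (bigD1 x) //= ffunE eqxx big1 => [|g ngx].
  by rewrite addr0; case: (x \in S).
by rewrite ffunE eq_sym (negPf ngx) if_same.
Qed.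

Lemma gsetV_coef S x : gsetV S x = (x^-1%g \in S)%:R.
Proof.
rewrite sum_ffunE big_mkcond (bigD1 x^-1%g) //= ffunE invgK eqxx big1.
  by rewrite addr0; case: (_ \in S).
move=> g ngx; rewrite ffunE -(inj_eq invg_inj) invgK eq_sym (negPf ngx).
by rewrite if_same.
Qed.

Lemma gset_mulV_coef S1 S2 x :
  (gset S1 * gsetV S2) x = #|S1 :&: (x *: S2)%g|%:R.
Proof.
rewrite ffunE -sum1_card natr_sum [RHS]big_mkcond /=; apply: eq_bigr => h _.
rewrite gset_coef gsetV_coef inE mem_lcoset invMg invgK -natrM mulnb.
by case: (_ && _).
Qed.

Lemma linking_coef_two_valued S1 S2 D (mu nu : int) x y :
    gset S1 * gsetV S2 = gset D *~ (mu - nu) + gset [set: gT] *~ nu ->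
    (x \in D) = (y \in D) ->
  #|S1 :&: (x *: S2)%g| = #|S1 :&: (y *: S2)%g|.
Proof.
move=> eD xyD; apply/eqP; rewrite -(Num.Theory.eqr_nat int) -!gset_mulV_coef eD.
by rewrite !ffunE !ffunMzE !gset_coef xyD !inE.
Qed.

End GroupRingCoefficients.

(** * Hyperplane subgroups *)

(** In [card_vspace] the carrier of the vector space is a finite type. Unpacking
V lets its own structure be used on the finite copy [finvect_type V]. *)
Lemma card_finvect_vspace (F : finFieldType) (V : vectType F)
    (W : {vspace V}) :
  #|[pred w : finvect_type V | (w : V) \in W]| = #|F| ^ \dim W.
Proof.
case: V W => T classT W.
exact: (@card_vspace F (finvect_type (Vector.Pack classT)) classT W).
Qed.

Section Hyperplanes.
Import GRing.Theory.
Variables (F : finFieldType) (V : vectType F).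
Variables (G : finGroupType) (E : {group G}) (phi : G -> V).
Hypothesis phi_isom : additive_isom E phi.

Lemma subgroup_of_group_set (W : {vspace V}) :
  group_set (subgroup_of E phi W).
Proof.
have [phiM _ _] := phi_isom.
apply/group_setP; split=> [|x y].
  rewrite inE group1 /= -[phi _](addrK (phi 1%g)) -phiM // mulg1 subrr.
  exact: mem0v.
rewrite !inE => /andP[Ex Wx] /andP[Ey Wy].
by rewrite groupM //= phiM // memvD.
Qed.

Definition hyperplane_group (W : {vspace V}) : {group G} :=
  Group (subgroup_of_group_set W).

Lemma subgroup_of_sub (W : {vspace V}) : subgroup_of E phi W \subset E.
Proof. by apply/subsetP=> x; rewrite inE => /andP[]. Qed.

Lemma card_subgroup_of (W : {vspace V}) :
  #|subgroup_of E phi W| = #|F| ^ \dim W.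
Proof.
have [_ phi_inj phi_surj] := phi_isom.
pose f : G -> finvect_type V := phi.
rewrite -card_finvect_vspace -(card_in_imset (f := f)); last first.
  by move=> x y; rewrite !inE => /andP[Ex _] /andP[Ey _]; apply: phi_inj.
apply: eq_card => w; apply/imsetP/idP => [[x xW ->]|Ww].
  by move: xW; rewrite inE => /andP[].
by have [x Ex xw] := phi_surj w; exists x; rewrite // inE Ex xw.
Qed.

Lemma dim_hyperplaneI (W1 W2 : {vspace V}) :
    hyperplane W1 -> hyperplane W2 -> W1 != W2 ->
  (\dim (W1 :&: W2)).+2 = \dim {:V}.
Proof.
rewrite /hyperplane => dW1 dW2 nW.
have dimD : \dim (W1 + W2) = \dim {:V}.
  have le_dim := dimvS (subvf (W1 + W2)).
  apply/eqP; rewrite eqn_leq le_dim -dW1 ltnNge.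
  apply: contra nW => le_dimD.
  have /eqP e1 : (W1 == (W1 + W2)%VS) by rewrite eqEdim addvSl.
  have le21: (W2 <= W1)%VS by rewrite e1 addvSr.
  by rewrite eq_sym eqEdim le21; lia.
by have := dimv_sum_cap W1 W2; rewrite dimD; lia.
Qed.

(** The intersection has codimension 2, and the product formula then gives that
the two subgroups generate E; so every translate by E meets alike. *)
Lemma card_subgroup_ofI (W1 W2 : {vspace V}) d e :
    \dim {:V} = d.+2 -> hyperplane W1 -> hyperplane W2 -> W1 != W2 ->
    e \in E ->
  #|subgroup_of E phi W1 :&: (e *: subgroup_of E phi W2)%g| = #|F| ^ d.
Proof.
move=> dV hW1 hW2 nW Ee.
pose H1 := hyperplane_group W1; pose H2 := hyperplane_group W2.
have oI : #|H1 :&: H2| = #|F| ^ d.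
  have := dim_hyperplaneI hW1 hW2 nW; rewrite dV => -[<-].
  rewrite -card_subgroup_of; apply: eq_card => x.
  by rewrite !inE memv_cap; case: (x \in E).
rewrite -oI; apply: (@card_lcosetI_mul _ H1 H2).
have -> // : (H1 * H2)%g = E.
apply/eqP; rewrite eqEcard mul_subG ?subgroup_of_sub //=.
have oE : #|E| = #|F| ^ d.+2.
  rewrite -dV -card_subgroup_of; apply: eq_card => x; rewrite inE memvf.
  by rewrite andbT.
have := mul_cardG H1 H2; rewrite oI !card_subgroup_of oE.
move: hW1 hW2; rewrite /hyperplane dV => -[->] [->].
rewrite -expnD addSnnS addnC expnD => /eqP.
rewrite eqn_pmul2r => [/eqP->|]; first exact: leqnn.
by rewrite expn_gt0 (ltnW (finNzRing_gt1 F)).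
Qed.

(** Two Dillon sets may come with different enumerations of the hyperplanes,
which differ by a permutation sigma of the indices. Permuting the
representatives by its extension tau, which fixes the index 0 of the missing
coset, makes the enumerations agree. *)
Lemma mcfarland_dillon_enum s (W : 'I_s -> {vspace V}) (D : {set G}) :
    hyperplane_enum W -> mcfarland_dillon E phi s D ->
  exists2 g : 'I_s.+1 -> G, coset_representatives E g &
    D = \bigcup_(i < s) (g (lift ord0 i) *: subgroup_of E phi (W i))%g.
Proof.
move=> [W_inj W_hyp] [W' [g [[W'_inj W'_hyp] repg ->]]].
have ex_sigma i : exists j, W' j == W i.
  have /W'_hyp[j Wj] : hyperplane (W i) by apply/W_hyp; exists i.
  by exists j; apply/eqP.
pose sigma i := xchoose (ex_sigma i).
have W'sigma i : W' (sigma i) = W i by apply/eqP/(xchooseP (ex_sigma i)).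
have sigma_inj : injective sigma.
  by move=> i j eij; apply: W_inj; rewrite -!W'sigma eij.
pose tau (i : 'I_s.+1) :=
  if unlift ord0 i is Some j then lift ord0 (sigma j) else ord0.
have tau_lift i : tau (lift ord0 i) = lift ord0 (sigma i) by rewrite /tau liftK.
have tau0 : tau ord0 = ord0 by rewrite /tau unlift_none.
have tau_inj : injective tau.
  move=> i j; case: (unliftP ord0 i) => [i' ->|->];
    case: (unliftP ord0 j) => [j' ->|->]; rewrite ?tau_lift ?tau0 //.
  by move/lift_inj/sigma_inj->.
have [tau' tauK tau'K] := injF_bij tau_inj.
exists (g \o tau) => [x|].
  have [i [xi uniq_i]] := repg x; exists (tau' i); split=> [|j /uniq_i ->].
    by rewrite /= tau'K.
  by rewrite tauK.
rewrite (reindex_inj sigma_inj); apply: eq_bigr => i _ /=.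
by rewrite tau_lift W'sigma.
Qed.

End Hyperplanes.

Theorem theorem4p4 (p m q d s : nat)
    (p_prime : prime p) (m_gt0 : (0 < m)%N) (q_def : q = (p ^ m)%N)
    (q_gt2 : (2 < q)%N) (d_gt0 : (0 < d)%N)
    (s_def : s = ((q ^ d.+1 - 1) %/ (q - 1))%N)
    (F : finFieldType) (card_F : #|F| = q)
    (V : vectType F) (dim_V : \dim {:V} = d.+1)
    (G : finGroupType) (E : {group G})
    (E_central : E \subset ('Z([set: G]))%g)
    (E_index : #|[set: G] : E|%g = s.+1)
    (E_abelem : (p.-abelem E)%g) (card_E : #|E| = (q ^ d.+1)%N)
    (phi : G -> V) (phi_isom : additive_isom E phi)
    (l : nat) (l_ge2 : (2 <= l)%N) :
  ~ exists DD : {set {set G}},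
      reduced_linking_system (q ^ d.+1 * s.+1)%N (q ^ d * s)%N
        (q ^ d * (s - q ^ d))%N (q ^ (2 * d))%N l DD /\
      exists D1 D2 : {set G},
        [/\ D1 \in DD, D2 \in DD, D1 != D2,
            mcfarland_dillon E phi s D1 & mcfarland_dillon E phi s D2].
Proof.
case: d d_gt0 s_def dim_V card_E => // d' _ s_def dim_V card_E.
case=> DD [[_ _ _ [mu [nu linkDD]]] [D1 [D2 [DD1 DD2 nD dillon1 dillon2]]]].
have [D [_ oD _ _] eD] := linkDD D1 D2 DD1 DD2 nD.
have [W [g [enumW _ _]]] := dillon1.
have [a repa eD1] := mcfarland_dillon_enum enumW dillon1.
have [b repb eD2] := mcfarland_dillon_enum enumW dillon2.
have [W_inj W_hyp] := enumW.
have hypW i : hyperplane (W i) by apply/W_hyp; exists i.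
have q_lt_s : q < s.
  rewrite s_def leq_divRL; last by lia.
  have : q ^ 2 <= q ^ d'.+2 by rewrite leq_exp2l //; lia.
  rewrite expnS expn1; nia.
apply: (@card_translateI_not_two_valued G E s q (q ^ d')
          (fun i => hyperplane_group phi_isom (W i)) a b
          _ _ _ _ _ _ _ _ _ _ _ D).
- exact: q_gt2.
- exact: q_lt_s.
- by rewrite expn_gt0; lia.
- exact: E_central.
- by rewrite card_E -expnD addn2.
- by rewrite -E_index Lagrange // subsetT.
- by move=> i; apply: subgroup_of_sub.
- move=> i; rewrite card_subgroup_of // card_F -expnSr.
  by move: (hypW i); rewrite /hyperplane dim_V => -[->].
- move=> i j e nij Ee; rewrite -card_F; apply: card_subgroup_ofI => //.
  by apply: contra nij => /eqP/W_inj->.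
- exact: repa.
- exact: repb.
- by rewrite oD expnSr.
by move=> x y; rewrite -eD1 -eD2; apply: linking_coef_two_valued eD.
Qed.
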